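(* Let $\mathbf X\in\mathbb C^{D\times N}$ and let $K$ be an integer with $1\le K<\operatorname{rank}(\mathbf X)$. Then $$\max_{\mathbf Q\in\mathbb C^{D\times K},\ \mathbf Q^H\mathbf Q=\mathbf I_K}\|\mathbf Q^H\mathbf X\|_1 \;=\; \max_{\substack{\mathbf Q\in\mathbb C^{D\times K},\ \mathbf Q^H\mathbf Q=\mathbf I_K\\ \mathbf B\in U^{N\times K}}}\Re\{\operatorname{Tr}(\mathbf B\mathbf Q^H\mathbf X)\} \;=\; \max_{\mathbf B\in U^{N\times K}}\|\mathbf X\mathbf B\|_* .$$
   Context: $U=\{z\in\mathbb C:|z|=1\}$, and $U^{N\times K}$ is the set of $N\times K$ matrices all of whose entries lie in $U$ (unimodular matrices). For $\mathbf A\in\mathbb C^{m\times n}$, $\|\mathbf A\|_1=\sum_{i,j}|A_{i,j}|$ is the entrywise L1-norm and $\|\mathbf A\|_*$ is the nuclear norm (sum of the singular values). $(\cdot)^H$ denotes conjugate transpose, $\mathbf I_K$ the $K\times K$ identity, and $\Re$ the real part. *)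

(* Defs.v *)
From HB Require Import structures.
From mathcomp Require Import all_boot all_order all_algebra.
From mathcomp Require Import all_classical all_reals.
From mathcomp Require Export complex.

Set Implicit Arguments.
Unset Strict Implicit.
Unset Printing Implicit Defensive.

Import Order.TTheory GRing.Theory Num.Theory.

Local Open Scope ring_scope.
Local Open Scope classical_set_scope.
Local Open Scope sesquilinear_scope.

(* Throughout, the complex field is R[i] for R : realType, and [A^t*] is the   *)
(* conjugate transpose. Norms and real parts are R-valued: [normc] and         *)
(* [complex.Re] both go from R[i] to R.                                        *)

Definition l1norm (R : realType) (m n : nat) (A : 'M[R[i]]_(m, n)) : R :=
  \sum_(i < m) \sum_(j < n) Normc.normc (A i j).

(* Square roots of the eigenvalues of the Hermitian positive semidefinite      *)
(* matrix A^H A, with multiplicity ([spectral_diag] lists the diagonal of a    *)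
(* unitary diagonalization, whose entries are here real and nonnegative).      *)
(* There are n of them; in the convention with min(m, n) singular values, the  *)
(* n - min(m, n) extra ones are zero and do not affect the nuclear norm.       *)
Definition singular_value (R : realType) (m n : nat) (A : 'M[R[i]]_(m, n))
    (j : 'I_n) : R :=
  Num.sqrt (complex.Re (spectral_diag (A^t* *m A) 0 j)).

Definition nuclear_norm (R : realType) (m n : nat) (A : 'M[R[i]]_(m, n)) : R :=
  \sum_(j < n) singular_value A j.

Definition orthonormal_cols (R : realType) (D K : nat) : set 'M[R[i]]_(D, K) :=
  [set Q | Q^t* *m Q = 1%:M].

Definition unimodular (R : realType) (N K : nat) : set 'M[R[i]]_(N, K) :=
  [set B | forall i j, Normc.normc (B i j) = 1].

(* An attained maximum. *)
Definition is_max (R : realType) (S : set R) (v : R) : Prop :=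
  S v /\ ubound S v.

(* Main.v *)
Require Import Defs.
From HB Require Import structures.
From mathcomp Require Import all_boot all_order all_algebra.
From mathcomp Require Import all_classical all_reals.
From mathcomp Require Import topology normedtype derive realfun.

(** For fixed Q, the trace Re Tr(B Q^H X) is at most ||Q^H X||_1, with equality
    when the entries of B are the conjugate phases of those of (Q^H X)^T. For
    fixed B, with A = X B, diagonalize A^H A = P^H diag(d) P: the rows Y_i of
    P A^H are orthogonal with squared norms d_i, and Tr(Q^H A) is the sum of the
    inner products of the rows of P Q^H, which are orthonormal, with the Y_i.
    Cauchy-Schwarz bounds its real part by the nuclear norm of A, and equality
    holds when the rows of P Q^H are the normalized Y_i, completed to an
    orthonormal family where Y_i = 0; this needs K <= D. So maximizing the trace
    over either variable first gives one of the other two problems, and the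
    maxima exist because the matrices with orthonormal columns form a compact
    set. *)

Import Order.TTheory GRing.Theory Num.Theory.
Import numFieldNormedType.Exports.
Set Implicit Arguments.
Unset Strict Implicit.

Local Open Scope ring_scope.
Local Open Scope classical_set_scope.
Local Open Scope sesquilinear_scope.

Local Notation "''[' u , v ]" := (dotmx u v) : ring_scope.
Local Notation "''[' u ]" := (dotmx u u) : ring_scope.

(** * Orthonormal completion and trace duality for the nuclear norm *)

Section NuclearNormDuality.
Variable C : numClosedFieldType.

Lemma dotmx_rowE m n (A B : 'M[C]_(m, n)) i j :
  '[row i A, row j B] = (A *m B^t*) i j.
Proof. by rewrite dotmxE !mxE; apply: eq_bigr => k _; rewrite !mxE. Qed.

(** The left kernel of [U^t*] has dimension [n - \rank U > 0]; any nonzero vector in it can be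
    normalized. *)
Lemma unit_orthogonal_vector m n (U : 'M[C]_(m, n)) : (\rank U < n)%N ->
  exists2 v : 'rV[C]_n, '[v] = 1 & forall i, '[row i U, v] = 0.
Proof.
move=> rkU.
have /rowV0Pn[v v_ker v_neq0] : kermx (U^t*) != 0.
  by rewrite -mxrank_eq0 mxrank_ker mxrank_map mxrank_tr -lt0n subn_gt0.
have vU := sub_kermxP v_ker.
exists ((sqrtC '[v])^-1 *: v).
  rewrite dnormZ normfV ger0_norm ?sqrtC_ge0 ?dnorm_ge0 //.
  by rewrite exprVn sqrtCK mulVf // dnorm_eq0.
move=> i; rewrite linearZr_LR /=; suff -> : '[row i U, v] = 0 by rewrite mulr0.
rewrite dotmxE; suff -> : row i U *m v^t* = 0 by rewrite mxE.
rewrite -row_mul; suff -> : U *m v^t* = 0 by rewrite row0.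
by rewrite -[LHS]trmxCK !trmx_mul !map_mxM /= trmxCK vU trmx0 map_mx0.
Qed.

(* The indices outside [b] mark zero rows; each one is replaced in turn by a
   unit vector orthogonal to all the others. *)
Lemma unitary_completion m n (b : pred 'I_m) (U : 'M[C]_(m, n)) :
    (m <= n)%N ->
    (forall i j, '[row i U, row j U] = ((i == j) && b i)%:R) ->
  exists2 W : 'M[C]_(m, n), W \is unitarymx &
    forall i, b i -> row i W = row i U.
Proof.
move=> le_mn; have [k] := ubnP #|predC b|.
elim: k => // k IHk in b U *; rewrite ltnS => le_bk oU.
have [[i0 bi0]|allb] := pselect (exists i, ~~ b i); last first.
  have bT i : b i by apply/negPn/negP => nbi; apply: allb; exists i.
  exists U => //; apply/row_unitarymxP => i j; rewrite oU bT andbT //.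
have Ui0 : row i0 U = 0.
  by have /eqP := oU i0 i0; rewrite (negPf bi0) andbF dnorm_eq0 => /eqP.
have /unit_orthogonal_vector [v v1 Uv] : (\rank U < n)%N.
  (* At full row rank [U] would have a right inverse [V], but row [i0] of [U *m V] vanishes along
     with that of [U]. *)
  apply: leq_trans le_mn; rewrite ltn_neqAle rank_leq_row andbT.
  apply/negP => /row_freeP[V UV1].
  have : delta_mx 0 i0 *m (U *m V) = delta_mx 0 i0 :> 'rV[C]_m.
    by rewrite UV1 mulmx1.
  rewrite mulmxA -rowE Ui0 mul0mx => /matrixP/(_ 0 i0).
  by rewrite !mxE !eqxx => /esym/eqP; rewrite oner_eq0.
have vU i : '[v, row i U] = 0.
  by rewrite hermC /= Uv conjC0 mulr0.
pose b' := [pred i | (i == i0) || b i].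
pose U' := \matrix_i (if i == i0 then v else row i U).
have [||W Wu WU'] := IHk b' U'.
- apply: leq_trans le_bk; apply/proper_card/properP; split.
    by apply/fintype.subsetP => i; rewrite !inE negb_or => /andP[].
  by exists i0; rewrite !inE ?eqxx.
- move=> i j; rewrite !rowK /=.
  have [ei|ni] := eqVneq i i0; have [ej|nj] := eqVneq j i0.
  + by rewrite v1 ei ej eqxx.
  + by rewrite vU ei eq_sym (negPf nj).
  + by rewrite Uv ej (negPf ni).
  + by rewrite oU.
exists W => // i bi; rewrite WU' /= ?bi ?orbT // rowK.
by case: eqP => // ei; rewrite -ei bi in bi0.
Qed.

Lemma normal_spectralE n (M : 'M[C]_n) : M \is normalmx ->
  spectralmx M *m M *m (spectralmx M)^t* = diag_mx (spectral_diag M).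
Proof.
move=> /orthomx_spectralP ME; have := spectral_unitarymx M; move: ME.
set P := spectralmx M; set d := spectral_diag M => ME Pu.
by rewrite ME invmx_unitary // !mulmxA (unitarymxP Pu) mul1mx mulmxtVK.
Qed.

Lemma gram_spectralE m n (A : 'M[C]_(m, n)) (P := spectralmx (A^t* *m A)) :
  (P *m A^t*) *m (P *m A^t*)^t* = diag_mx (spectral_diag (A^t* *m A)).
Proof.
rewrite -normal_spectralE; first by rewrite !trmx_mul !map_mxM /= trmxCK !mulmxA.
by apply/normalmxP; rewrite !trmx_mul !map_mxM /= trmxCK.
Qed.

Lemma spectral_diag_gram m n (A : 'M[C]_(m, n)) i
    (Y := spectralmx (A^t* *m A) *m A^t*) :
  spectral_diag (A^t* *m A) 0 i = '[row i Y].
Proof. by rewrite dotmx_rowE gram_spectralE !mxE eqxx mulr1n. Qed.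

Lemma spectral_diag_gram_ge0 m n (A : 'M[C]_(m, n)) i :
  0 <= spectral_diag (A^t* *m A) 0 i.
Proof. by rewrite spectral_diag_gram dnorm_ge0. Qed.

Lemma Re_trace_le_nuclear D K (A Q : 'M[C]_(D, K)) : Q^t* *m Q = 1%:M ->
  'Re (\tr (Q^t* *m A)) <= \sum_i sqrtC (spectral_diag (A^t* *m A) 0 i).
Proof.
move=> Q1; set P := spectralmx (A^t* *m A).
have Pu : P \is unitarymx by apply: spectral_unitarymx.
have Wu : P *m Q^t* \is unitarymx.
  by apply: mul_unitarymx => //; apply/unitarymxP; rewrite trmxCK.
pose Y := P *m A^t*.
have -> : \tr (Q^t* *m A) = \sum_i '[row i (P *m Q^t*), row i Y].
  (* As [Y^t*] is [A *m P^t*], cycling the trace brings [P^t*] next to [P], and the two cancel. *)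
  transitivity (\tr (P *m Q^t* *m Y^t*)).
    rewrite /Y !trmx_mul !map_mxM /= trmxCK mulmxA [RHS]mxtrace_mulC !mulmxA.
    by rewrite -invmx_unitary // mulVmx ?mul1mx // unitarymx_unit.
  by apply: eq_bigr => i _; rewrite dotmx_rowE.
rewrite raddf_sum /=; apply: ler_sum => i _.
apply: (le_trans (leif_Re_Creal _)).
have CS : `|'[row i (P *m Q^t*), row i Y]| <=
    sqrtC '[row i (P *m Q^t*)] * sqrtC '[row i Y].
  by apply: (CauchySchwarz_sqrt _ _ _).
apply: (le_trans CS); rewrite -spectral_diag_gram.
by rewrite (row_unitarymxP Wu) eqxx sqrtC1 mul1r.
Qed.

Lemma Re_trace_eq_nuclear D K (A : 'M[C]_(D, K)) : (K <= D)%N ->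
  exists2 Q : 'M[C]_(D, K), Q^t* *m Q = 1%:M &
    \tr (Q^t* *m A) = \sum_i sqrtC (spectral_diag (A^t* *m A) 0 i).
Proof.
move=> leKD; set P := spectralmx (A^t* *m A).
have Pu : P \is unitarymx by apply: spectral_unitarymx.
pose Y := P *m A^t*; pose s i := sqrtC (spectral_diag (A^t* *m A) 0 i).
have s_ge0 i : 0 <= s i by rewrite sqrtC_ge0 spectral_diag_gram_ge0.
have YE i j : '[row i Y, row j Y] = (s i ^+ 2) *+ (i == j).
  by rewrite dotmx_rowE gram_spectralE !mxE sqrtCK.
(* Since the inverse of 0 is 0, the rows with [s i = 0] are zero, as the completion requires. *)
have [] := @unitary_completion K D (fun i => s i != 0)
    (\matrix_i ((s i)^-1 *: row i Y)) leKD.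
  move=> i j; rewrite !rowK linearZl_LR linearZr_LR /= YE.
  have [->|_] := eqVneq i j; last by rewrite !mulr0.
  rewrite mulr1n conj_Creal ?realV ?ger0_real //=.
  have [->|nz] := eqVneq (s j) 0; first by rewrite expr0n /= !mulr0.
  by rewrite expr2 mulKf // mulVf.
move=> W Wu WY; have YW i : row i Y = s i *: row i W.
  (* If [s i = 0], then row [i] of [Y] has norm 0, so the identity holds whatever the completed row
     of [W] is. *)
  have [s0|nz] := eqVneq (s i) 0; last first.
    by rewrite WY // rowK scalerA divff // scale1r.
  by have /eqP := YE i i; rewrite s0 expr0n mul0rn dnorm_eq0 scale0r => /eqP.
(* This choice makes [P *m Q^t*] equal to [W]. *)
exists (W^t* *m P).
  rewrite trmx_mul map_mxM /= trmxCK mulmxA mulmxtVK //.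
  by rewrite -invmx_unitary // mulVmx // unitarymx_unit.
rewrite trmx_mul map_mxM /= trmxCK -mulmxA mxtrace_mulC -mulmxA.
have -> : A *m P^t* = Y^t* by rewrite trmx_mul map_mxM /= trmxCK.
apply: eq_bigr => i _; rewrite -dotmx_rowE YW linearZr_LR /=.
by rewrite (row_unitarymxP Wu) eqxx mulr1 conj_Creal // ger0_real.
Qed.

End NuclearNormDuality.

Lemma normc_ReIm (R : realType) (z : R[i]) :
  Normc.normc z = Num.sqrt (complex.Re z ^+ 2 + complex.Im z ^+ 2).
Proof. by case: z. Qed.

(** Turns the matrix equation defining orthonormal columns into the vanishing of one real-valued
    function, from which closedness follows. *)
Lemma l1norm_eq0 (R : realType) m n (A : 'M[R[i]]_(m, n)) :
  l1norm A = 0 <-> A = 0.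
Proof.
have nge0 (z : R[i]) : 0 <= Normc.normc z by rewrite normc_ReIm sqrtr_ge0.
split=> [A0|->]; last first.
  by do 2!apply: big1 => ? _; rewrite mxE Normc.normc0.
apply/matrixP => i j; rewrite mxE; apply: Normc.eq0_normc.
have /psumr_eq0P/(_ i isT) := A0; move=> /(_ (fun _ _ => sumr_ge0 _ _)).
move=> /(_ (fun _ _ _ => nge0 _)) /psumr_eq0P.
by apply.
Qed.

(** * Continuity of complex-valued functions *)

Section ComplexContinuity.
Variables (R : realType) (T : topologicalType).

(** Stated by components, so that only the topology of [R] is involved. *)
Definition complex_continuous (f : T -> R[i]) :=
  continuous (fun x => complex.Re (f x)) /\ continuous (fun x => complex.Im (f x)).

Lemma complex_continuous_cst c : complex_continuous (fun=> c).
Proof. by split => x; apply: cst_continuous. Qed.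

Lemma complex_continuousD f g :
  complex_continuous f -> complex_continuous g ->
  complex_continuous (fun x => f x + g x).
Proof.
move=> [f1 f2] [g1 g2]; split => x.
  under eq_fun do rewrite (raddfD (@complex.Re R : Rcomplex R -> R)).
  by apply: cvgD; [apply: f1|apply: g1].
under eq_fun do rewrite (raddfD (@complex.Im R : Rcomplex R -> R)).
by apply: cvgD; [apply: f2|apply: g2].
Qed.

Lemma complex_continuousM f g :
  complex_continuous f -> complex_continuous g ->
  complex_continuous (fun x => f x * g x).
Proof.
move=> [f1 f2] [g1 g2].
have ReM (a b : R[i]) : complex.Re (a * b)
    = complex.Re a * complex.Re b - complex.Im a * complex.Im b.
  by case: a b => [? ?] [? ?].
have ImM (a b : R[i]) : complex.Im (a * b)
    = complex.Re a * complex.Im b + complex.Im a * complex.Re b.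
  by case: a b => [? ?] [? ?].
split => x.
  under eq_fun do rewrite ReM.
  by apply: cvgB; apply: cvgM; [apply: f1|apply: g1|apply: f2|apply: g2].
under eq_fun do rewrite ImM.
by apply: cvgD; apply: cvgM; [apply: f1|apply: g2|apply: f2|apply: g1].
Qed.

Lemma complex_continuous_conj f :
  complex_continuous f -> complex_continuous (fun x => (f x)^*).
Proof.
have ReJ (z : R[i]) : complex.Re z^* = complex.Re z by case: z.
have ImJ (z : R[i]) : complex.Im z^* = - complex.Im z by case: z.
move=> [f1 f2]; split => x.
  by under eq_fun do rewrite ReJ; apply: f1.
by under eq_fun do rewrite ImJ; apply: cvgN; apply: f2.
Qed.

Lemma complex_continuous_sum (I : Type) (r : seq I) (F : I -> T -> R[i]) :
  (forall i, complex_continuous (F i)) ->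
  complex_continuous (fun x => \sum_(i <- r) F i x).
Proof.
move=> cF; elim: r => [|i r IHr].
  have -> : (fun x => \sum_(i <- [::]) F i x) = (fun=> 0).
    by apply/funext => x; rewrite big_nil.
  exact: complex_continuous_cst.
have -> : (fun x => \sum_(j <- i :: r) F j x)
    = (fun x => F i x + \sum_(j <- r) F j x).
  by apply/funext => x; rewrite big_cons.
exact: complex_continuousD.
Qed.

Lemma continuous_normc f :
  complex_continuous f -> continuous (fun x => Normc.normc (f x)).
Proof.
move=> [f1 f2] x; under eq_fun do rewrite normc_ReIm.
apply: (@continuous_comp _ _ _
  (fun x => complex.Re (f x) ^+ 2 + complex.Im (f x) ^+ 2) Num.sqrt); last exact: sqrt_continuous.
by apply: cvgD; apply: cvgM; (apply: f1 || apply: f2).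
Qed.

Lemma continuous_l1norm m n (M : T -> 'M[R[i]]_(m, n)) :
  (forall i j, complex_continuous (fun x => M x i j)) ->
  continuous (fun x => l1norm (M x)).
Proof.
move=> cM; apply: continuous_big => [|i _]; first exact: add_continuous.
apply: continuous_big => [|j _]; first exact: add_continuous.
exact: continuous_normc.
Qed.

End ComplexContinuity.

(** * Compactness of the set of matrices with orthonormal columns *)

Section StiefelCompactness.
Variables (R : realType) (D K : nat).

(* The first component selects the real or the imaginary part, so that Tychonoff's
   theorem over R applies. *)
Let coords := (bool * 'I_D * 'I_K)%type.
Let coordT : topologicalType := prod_topology (fun _ : coords => R).

Let complex_matrix (f : coordT) : 'M[R[i]]_(D, K) :=
  \matrix_(i, j) (f (false, i, j) +i* f (true, i, j))%C.

Let complex_matrix_surj (Q : 'M[R[i]]_(D, K)) :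
  exists f : coordT, complex_matrix f = Q.
Proof.
exists (fun p => let: (b, i, j) := p in
  if b then complex.Im (Q i j) else complex.Re (Q i j)).
by apply/matrixP => i j; rewrite mxE /=; case: (Q i j).
Qed.

Let complex_continuous_coord i j :
  complex_continuous (fun f : coordT => complex_matrix f i j).
Proof.
split => f; under eq_fun do rewrite mxE /=.
  exact: (@proj_continuous coords (fun=> R) (false, i, j)).
exact: (@proj_continuous coords (fun=> R) (true, i, j)).
Qed.

Let complex_continuous_adjoint_mul n (M : coordT -> 'M[R[i]]_(D, n)) :
  (forall i j, complex_continuous (fun f => M f i j)) ->
  forall i j, complex_continuous (fun f => ((complex_matrix f)^t* *m M f) i j).
Proof.
move=> cM i j; under [X in complex_continuous X]eq_fun do rewrite mxE.
apply: complex_continuous_sum => k; apply: complex_continuousM; last exact: cM.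
under [X in complex_continuous X]eq_fun do rewrite mxE mxE.
exact: complex_continuous_conj.
Qed.

(** The squared moduli of the entries of column [j] sum to the diagonal entry [(j, j)] of
    [Q^t* *m Q], which is 1. *)
Lemma normc_entry_orthonormal (Q : 'M[R[i]]_(D, K)) i j :
  Q^t* *m Q = 1%:M -> Normc.normc (Q i j) <= 1.
Proof.
move=> /matrixP/(_ j j); rewrite !mxE eqxx mulr1n => Q1.
have: `|Q i j| ^+ 2 <= 1.
  rewrite -Q1 (bigD1 i) //= !mxE normCKC lerDl.
  by apply: sumr_ge0 => k _; rewrite !mxE -normCKC exprn_ge0.
by rewrite expr_le1 // -lecR.
Qed.

(** A closed subset of the cube of side [[-1, 1]], which is compact by Tychonoff. *)
Lemma compact_orthonormal_coords :
  compact [set f : coordT | orthonormal_cols (complex_matrix f)].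
Proof.
pose box : set coordT := [set f | forall p, f p \in `[-1, 1]%R].
have box_compact : compact box.
  apply: (@tychonoff coords (fun=> R) (fun=> `[-1, 1]%classic)) => p.
  exact: segment_compact.
apply: (subclosed_compact _ box_compact); last first.
  move=> f fQ [[b i] j]; rewrite in_itv /= -ler_norml.
  apply: le_trans (normc_entry_orthonormal i j fQ).
  rewrite mxE normc_ReIm /= -sqrtr_sqr ler_sqrt ?addr_ge0 ?sqr_ge0 //.
  by case: b; rewrite ?lerDl ?lerDr sqr_ge0.
pose defect (f : coordT) :=
  l1norm ((complex_matrix f)^t* *m complex_matrix f - 1%:M).
have -> : [set f | orthonormal_cols (complex_matrix f)] = defect @^-1` [set 0].
  apply/funext => f; apply/propext; rewrite /defect /=.
  by rewrite /= l1norm_eq0; split => [->|/subr0_eq//]; rewrite subrr.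
apply: preimage_closed; last exact: closed_eq.
move=> f _; apply: continuous_l1norm => i j.
under [X in complex_continuous X]eq_fun do rewrite mxE.
apply: complex_continuousD; first exact: complex_continuous_adjoint_mul.
exact: complex_continuous_cst.
Qed.

Lemma l1norm_adjoint_mul_max N (X : 'M[R[i]]_(D, N)) : (K <= D)%N ->
  exists2 Q, @orthonormal_cols R D K Q &
    forall Q' : 'M_(D, K), orthonormal_cols Q' ->
      l1norm (Q'^t* *m X) <= l1norm (Q^t* *m X).
Proof.
move=> leKD; pose f0 (f : coordT) := l1norm ((complex_matrix f)^t* *m X).
have nonempty : [set f : coordT | orthonormal_cols (complex_matrix f)] !=set0.
  (* For [K <= D], Gram-Schmidt yields orthonormal rows even from the zero matrix; the adjoint has
     orthonormal columns. *)
  have /unitarymxP := schmidt_unitarymx (0 : 'M[R[i]]_(K, D)) leKD.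
  set S := schmidt _ => S1; have [f fS] := complex_matrix_surj (S^t*).
  by exists f; rewrite /= fS /orthonormal_cols /= trmxCK.
have cf0 : continuous f0.
  apply: continuous_l1norm; apply: complex_continuous_adjoint_mul => i j.
  exact: complex_continuous_cst.
have [c cQ cmax] := compact_EVT_max nonempty compact_orthonormal_coords
  (continuous_subspaceT cf0).
exists (complex_matrix c); first by rewrite inE in cQ.
move=> Q' Q'1; have [f fQ'] := complex_matrix_surj Q'.
by rewrite -fQ'; apply: cmax; rewrite inE /= fQ'.
Qed.

End StiefelCompactness.

(** * Real-valued bounds on the trace by the nuclear and L1 norms *)

Section NuclearNorm.
Variable R : realType.

(** Links the real square root in [nuclear_norm] to the [sqrtC] of the duality lemmas: a nonnegative
    [d] is real. *)
Lemma sqrtC_Re (d : R[i]) :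
  0 <= d -> (Num.sqrt (complex.Re d))%:C%C = sqrtC d.
Proof.
move=> d_ge0; have dE : (complex.Re d)%:C%C = d by rewrite RRe_real ?ger0_real.
have Rd_ge0 : 0 <= complex.Re d by rewrite -ler0c dE.
rewrite -[d in RHS]dE -[in RHS](sqr_sqrtr Rd_ge0) rmorphXn /= sqrCK //.
by rewrite ler0c sqrtr_ge0.
Qed.

Lemma nuclear_normE D K (A : 'M[R[i]]_(D, K)) :
  (nuclear_norm A)%:C%C = \sum_i sqrtC (spectral_diag (A^t* *m A) 0 i).
Proof.
rewrite rmorph_sum; apply: eq_bigr => i _.
exact/sqrtC_Re/spectral_diag_gram_ge0.
Qed.

Lemma Re_trace_le_nuclear_norm D K (A Q : 'M[R[i]]_(D, K)) :
  orthonormal_cols Q -> complex.Re (\tr (Q^t* *m A)) <= nuclear_norm A.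
Proof.
by move=> Q1; rewrite -lecR nuclear_normE complexRe; exact: Re_trace_le_nuclear.
Qed.

Lemma Re_trace_eq_nuclear_norm D K (A : 'M[R[i]]_(D, K)) : (K <= D)%N ->
  exists2 Q : 'M_(D, K),
    orthonormal_cols Q & complex.Re (\tr (Q^t* *m A)) = nuclear_norm A.
Proof.
move=> /(Re_trace_eq_nuclear A)[Q Q1 QA]; exists Q => //.
by rewrite QA -nuclear_normE.
Qed.

Lemma Re_le_normc (z : R[i]) : complex.Re z <= Normc.normc z.
Proof. by rewrite -lecR (le_trans _ (normc_ge_Re z)) // lecR ler_norm. Qed.

Lemma Re_sum (I : Type) (r : seq I) (F : I -> R[i]) :
  complex.Re (\sum_(i <- r) F i) = \sum_(i <- r) complex.Re (F i).
Proof. exact: (raddf_sum (@complex.Re R : Rcomplex R -> R)). Qed.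

Lemma Re_trace_mul m n (B : 'M[R[i]]_(n, m)) (A : 'M[R[i]]_(m, n)) :
  complex.Re (\tr (B *m A)) = \sum_i \sum_j complex.Re (B j i * A i j).
Proof.
rewrite exchange_big /= Re_sum; apply: eq_bigr => j _.
by rewrite mxE Re_sum.
Qed.

Lemma Re_trace_le_l1norm m n (B : 'M[R[i]]_(n, m)) (A : 'M[R[i]]_(m, n)) :
  unimodular B -> complex.Re (\tr (B *m A)) <= l1norm A.
Proof.
move=> B1; rewrite Re_trace_mul; do 2!apply: ler_sum => ? _.
by apply: le_trans (Re_le_normc _) _; rewrite Normc.normcM B1 mul1r.
Qed.

Lemma Re_trace_eq_l1norm m n (A : 'M[R[i]]_(m, n)) :
  exists2 B : 'M_(n, m),
    unimodular B & complex.Re (\tr (B *m A)) = l1norm A.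
Proof.
have phase (z : R[i]) : exists u : R[i],
    Normc.normc u = 1 /\ complex.Re (u * z) = Normc.normc z.
  (* At [z = 0] the quotient [|z| / z] would be 0, which is not unimodular, so 1 is taken
     instead. *)
  have [->|nz] := eqVneq z 0.
    by exists 1; rewrite mulr0 Normc.normc0 Normc.normc1.
  exists (`|z| / z); split.
    apply: (@complexI R); have -> (u : R[i]) : (Normc.normc u)%:C%C = `|u| by [].
    by rewrite normf_div normr_id divff // normr_eq0.
  by rewrite divfK.
have [u uP] := choice phase.
exists (\matrix_(i, j) u (A j i)) => [i j|]; first by rewrite mxE (uP _).1.
rewrite Re_trace_mul; do 2!apply: eq_bigr => ? _.
by rewrite mxE (uP _).2.
Qed.

End NuclearNorm.

(** * Equality of the three maxima *)

Unset Implicit Arguments.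

Theorem mainTheorem1 (R : realType) (D N K : nat) (X : 'M[R[i]]_(D, N))
    (hK1 : (1 <= K)%N) (hKr : (K < \rank X)%N) :
  exists v : R,
    [/\ is_max [set l1norm (Q^t* *m X) | Q in @orthonormal_cols R D K] v,
        is_max [set complex.Re (\tr (QB.2 *m QB.1^t* *m X))
               | QB in @orthonormal_cols R D K `*` @unimodular R N K] v
      & is_max [set nuclear_norm (X *m B) | B in @unimodular R N K] v].
Proof.
have leKD : (K <= D)%N := leq_trans (ltnW hKr) (rank_leq_row X).
have trE (Q : 'M[R[i]]_(D, K)) B :
    \tr (B *m Q^t* *m X) = \tr (Q^t* *m (X *m B)).
  by rewrite -mulmxA mxtrace_mulC mulmxA.
(* [Q] maximizes the L1 norm and [B] holds the matching phases; together they attain all three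
   maxima. *)
have [Q Q1 Qmax] := l1norm_adjoint_mul_max X leKD.
have [B B1 QB] := Re_trace_eq_l1norm (Q^t* *m X).
have Xnuc (B' : 'M_(N, K)) : unimodular B' ->
    nuclear_norm (X *m B') <= l1norm (Q^t* *m X).
  (* The nuclear norm is a trace at some [Q'], hence at most the L1 norm at [Q'], hence at most the
     one at [Q]. *)
  move=> B'1; have [Q' Q'1 <-] := Re_trace_eq_nuclear_norm (X *m B') leKD.
  rewrite -trE -mulmxA; apply: le_trans (Re_trace_le_l1norm _ B'1) _.
  exact: Qmax.
exists (l1norm (Q^t* *m X)); split; split.
- by exists Q.
- by move=> _ [Q' Q'1 <-]; exact: Qmax.
- by exists (Q, B) => //=; rewrite -mulmxA.
- move=> _ [[Q' B'] [/= Q'1 B'1] <-]; rewrite -mulmxA.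
  by apply: le_trans (Re_trace_le_l1norm _ B'1) _; exact: Qmax.
(* For the reverse inequality, the L1 norm at [Q] is the trace at [(Q, B)], which the nuclear norm
   of [X *m B] dominates. *)
- exists B => //; apply/eqP; rewrite eq_le Xnuc //= -QB mulmxA trE.
  exact: Re_trace_le_nuclear_norm.
- by move=> _ [B' B'1 <-]; exact: Xnuc.
Qed.
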